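(* (Journé's lemma for general product measures.) Let $\mu=\mu_n\times\mu_m$, where $\mu_n$ and $\mu_m$ are arbitrary locally finite Borel measures on $\mathbb{R}^n$ and $\mathbb{R}^m$, let $\mathcal D_n,\mathcal D_m$ be dyadic systems in $\mathbb{R}^n,\mathbb{R}^m$, and $\mathcal D=\mathcal D_n\times\mathcal D_m$. Let $\Omega\subset\mathbb{R}^{n+m}$ be a set with $\mu(\Omega)<\infty$ such that for every $x\in\Omega$ there is $R\in\mathcal D$ with $x\in R\subset\Omega$. Let $\omega\colon\mathbb{N}=\{0,1,2,\dots\}\to\mathbb{R}_+$ be a decreasing function with $\sum_{k=0}^\infty\omega(k)<\infty$. Then $$\sum_{\substack{R\in\mathcal D,\ R\subset\Omega\\ R\ \text{2-maximal}}}\omega(\operatorname{emb}_1(R;\Omega))\,\mu(R)\le 2\Big(\sum_{k=0}^\infty\omega(k)\Big)\mu(\Omega).$$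
   Context: A dyadic system in $\mathbb{R}^n$ is a family $\{I+\sum_{i:2^{-i}<\ell(I)}2^{-i}w_i: I\in\mathcal D_n^0\}$, where $\mathcal D^0_n$ is the standard dyadic grid (half-open cubes), $\ell(I)$ is the side length and $w_i\in\{0,1\}^n$ for $i\in\mathbb{Z}$; it is assumed to have no quadrants: any strictly increasing sequence of its cubes exhausts $\mathbb{R}^n$. Similarly in $\mathbb{R}^m$. For a dyadic cube $I$, $I^{(k)}$ denotes its $k$-th dyadic ancestor. For $R=I\times J\in\mathcal D$ put $R^{(i,j)}=I^{(i)}\times J^{(j)}$. $M$ is the strong dyadic maximal operator with respect to $\mathcal D$: $Mf(x)=\sup\{\mu(R)^{-1}\int_R|f|\,d\mu: x\in R\in\mathcal D\}$ (rectangles of zero measure being ignored), and $\tilde\Omega=\{M\chi_\Omega>\tfrac12\}$. The embeddedness is $\operatorname{emb}_1(R;\Omega)=\sup\{k\ge0: R^{(k,0)}\subset\tilde\Omega\}$; if this supremum is $\infty$, then $\omega(\infty)$ is read as $\lim_{k\to\infty}\omega(k)=0$. Rectangles with $\mu(R)=0$ contribute zero to the sum. A dyadic rectangle $R=I\times J\subset\Omega$ is called 2-maximal if $I\times\tilde J\not\subset\Omega$ for every dyadic $\tilde J\in\mathcal D_m$ with $\tilde J\supsetneq J$. *)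

(* Defs.v *)
From HB Require Import structures.
From mathcomp Require Import all_boot all_order all_algebra.
From mathcomp Require Import all_classical all_reals all_analysis.

Set Implicit Arguments.
Unset Strict Implicit.
Unset Printing Implicit Defensive.

Import Order.TTheory GRing.Theory Num.Theory.
Import numFieldNormedType.Exports.

Local Open Scope classical_set_scope.
Local Open Scope ring_scope.
Local Open Scope ereal_scope.

(* R^n with its Borel sigma-algebra; as a type it is convertible to
   'rV[R]_n, whose topology is the usual one. *)
Notation borelRn R n := (g_sigma_algebraType (@open 'rV[R]_n)).

Definition locally_finite (R : realType) (n : nat)
    (mu : set (borelRn R n) -> \bar R) : Prop :=
  forall x : 'rV[R]_n, exists U : set 'rV[R]_n,
    [/\ open U, U x & mu U < +oo].

(* The standard half-open dyadic cube of side length 2^-k whose lower corner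
   is 2^-k z. *)
Definition standard_cube (R : realType) (n : nat) (k : int) (z : 'rV[int]_n) :
    set 'rV[R]_n :=
  [set x : 'rV[R]_n | forall j : 'I_n,
     ((2 : R) ^ (- k) * (z ord0 j)%:~R <= x ord0 j
        < (2 : R) ^ (- k) * (z ord0 j + 1)%:~R)%R].
Arguments standard_cube R [n] k z _.

(* The sum of 2^-i w_i over the integers i with 2^-i < 2^-k, i.e. over
   i = k + 1, k + 2, etc. *)
Definition dyadic_shift (R : realType) (n : nat) (w : int -> 'rV[bool]_n)
    (k : int) : 'rV[R]_n :=
  \row_(j < n) limn (series (fun l : nat =>
    let i := (k + l.+1%:Z)%R in
    ((2 : R) ^ (- i) * (w i ord0 j)%:R)%R)).

(* The cubes of side length 2^-k of the dyadic system given by w. *)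
Definition dyadic_generation (R : realType) (n : nat) (w : int -> 'rV[bool]_n)
    (k : int) : set (set 'rV[R]_n) :=
  [set [set (x + dyadic_shift R w k)%R | x in standard_cube R k z] | z in setT].
Arguments dyadic_generation R [n] w k _.

Definition dyadic_system (R : realType) (n : nat) (w : int -> 'rV[bool]_n) :
    set (set 'rV[R]_n) :=
  \bigcup_(k in setT) dyadic_generation R w k.
Arguments dyadic_system R [n] w _.

Definition no_quadrants (R : realType) (n : nat) (D : set (set 'rV[R]_n)) :
    Prop :=
  forall I : nat -> set 'rV[R]_n,
    (forall i, D (I i)) -> (forall i, I i `<` I i.+1) ->
    \bigcup_i I i = setT.

(* I^(k): the cube of the system that contains I and whose side length is
   2^k times that of I. For n > 0 it exists and is unique for each cube I of
   the system; the default value of [xget] is then never used. *)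
Definition ancestor (R : realType) (n : nat) (w : int -> 'rV[bool]_n)
    (k : nat) (I : set 'rV[R]_n) : set 'rV[R]_n :=
  xget I [set J | exists g : int, [/\ dyadic_generation R w g I,
    dyadic_generation R w (g - k%:Z)%R J & I `<=` J]].

(* Rectangles I x J are encoded by the pair (I, J); those of measure zero do
   not enter the supremum. *)
Definition strong_maximal (R : realType) (n m : nat)
    (D1 : set (set 'rV[R]_n)) (D2 : set (set 'rV[R]_m))
    (mu : set (borelRn R n * borelRn R m) -> \bar R)
    (f : 'rV[R]_n * 'rV[R]_m -> R) (x : 'rV[R]_n * 'rV[R]_m) : \bar R :=
  ereal_sup [set (mu (Q.1 `*` Q.2))^-1 *
                 \int[mu]_(y in Q.1 `*` Q.2) `|f y|%:E |
    Q in [set Q : set 'rV[R]_n * set 'rV[R]_m |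
      [/\ D1 Q.1, D2 Q.2, (Q.1 `*` Q.2) x & 0 < mu (Q.1 `*` Q.2)]]].

Definition enlargement (R : realType) (n m : nat)
    (D1 : set (set 'rV[R]_n)) (D2 : set (set 'rV[R]_m))
    (mu : set (borelRn R n * borelRn R m) -> \bar R)
    (Omega : set ('rV[R]_n * 'rV[R]_m)) : set ('rV[R]_n * 'rV[R]_m) :=
  [set x | (2^-1)%:E < strong_maximal D1 D2 mu \1_Omega x].

(* The embeddedness emb_1 is a supremum of natural numbers, taken in the
   extended reals. It is -oo only if already I x J is not contained in the
   enlargement of Omega, which for I x J in Omega forces mu (I x J) = 0. *)
Definition emb1 (R : realType) (n m : nat)
    (wn : int -> 'rV[bool]_n) (wm : int -> 'rV[bool]_m)
    (mu : set (borelRn R n * borelRn R m) -> \bar R)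
    (Omega : set ('rV[R]_n * 'rV[R]_m))
    (I : set 'rV[R]_n) (J : set 'rV[R]_m) : \bar R :=
  ereal_sup [set k%:R%:E | k in [set k : nat |
    ancestor wn k I `*` J `<=`
      enlargement (dyadic_system R wn) (dyadic_system R wm) mu Omega]].

(* omega at a supremum of natural numbers, read as a limit at infinity. *)
Definition eval_sup (R : realType) (omega : nat -> R) (e : \bar R) : R :=
  match e with
  | r%:E => omega (Num.truncn r)
  | +oo => limn omega
  | -oo => omega 0%N
  end.

Definition two_maximal (R : realType) (n m : nat)
    (D2 : set (set 'rV[R]_m)) (Omega : set ('rV[R]_n * 'rV[R]_m))
    (I : set 'rV[R]_n) (J : set 'rV[R]_m) : Prop :=
  forall J', D2 J' -> J `<` J' -> ~ (I `*` J' `<=` Omega).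

(* Main.v *)
(* For fixed [k], let [s] be a finite family of 2-maximal rectangles [I x J]
   with embeddedness at most [k] whose sides [I] have generations in a single
   class modulo [k + 1]. If [I' x J'] in [s] meets [I x J] and [I] is a proper
   subset of [I'], then [J'] lies in [J] by 2-maximality and [I'] contains
   [L = I^(k+1)]. So if [A] is the union of these [J'], then [L x A] is
   contained in [Omega], whereas [Omega] fills at most half of [L x J] because
   [L x J] is not contained in the enlargement; hence [A] has at most half the
   mass of [J]. The cores [I x (J \ A)] are disjoint, which gives
   [\sum mu (I x J) <= 2 mu Omega], and [2 (k + 1) mu Omega] for all residue
   classes together. Summation by parts,
   [\sum_k (k + 1) (omega k - omega (k + 1)) = \sum_k omega k], absorbs the
   factor [k + 1]. *)

Require Import Defs.
From HB Require Import structures.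
From mathcomp Require Import all_boot all_order all_algebra.
From mathcomp Require Import all_classical all_reals all_analysis.
From mathcomp Require Import ring lra.

Set Implicit Arguments.
Unset Strict Implicit.
Unset Printing Implicit Defensive.

Import Order.TTheory GRing.Theory Num.Theory.
Import numFieldNormedType.Exports.

Local Open Scope classical_set_scope.
Local Open Scope ring_scope.
Local Open Scope ereal_scope.

(** * Dyadic cubes: integer indices, nesting and ancestors *)

Section DyadicSystem.
Context {R : realType} {n : nat}.
Implicit Types (w : int -> 'rV[bool]_n) (k : int) (x y : 'rV[R]_n).

(** With the cubes of a generation seen as the fibres of a map, their disjointness is immediate and
    nesting becomes arithmetic of integer vectors. *)
Definition cube_index w k x : 'rV[int]_n :=
  \row_j Num.floor (2 ^ k * (x ord0 j - dyadic_shift R w k ord0 j))%R.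

Lemma cube_indexE w k x j : cube_index w k x ord0 j =
  Num.floor (2 ^ k * (x ord0 j - dyadic_shift R w k ord0 j))%R.
Proof. by rewrite mxE. Qed.

Lemma dyadic_generationE w k :
  dyadic_generation R w k = [set cube_index w k @^-1` [set z] | z in setT].
Proof.
congr image; apply/funext => z; apply/seteqP.
have e2 : (0 < (2 : R) ^ k)%R by rewrite exprz_gt0.
have eN : ((2 : R) ^ k * 2 ^ (- k) = 1)%R.
  by rewrite -expfzDr ?subrr// pnatr_eq0.
have key (x : 'rV[R]_n) : (cube_index w k x = z) <->
    standard_cube R k z (x - dyadic_shift R w k)%R.
  split=> [<- j|h]; last first.
    apply/rowP => j; rewrite !mxE; apply: floor_def.
    have := h j; rewrite !mxE => /andP[h1 h2].
    rewrite -(ler_pM2l e2) mulrA eN mul1r in h1.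
    by rewrite -(ltr_pM2l e2) mulrA eN mul1r in h2; rewrite h1 h2.
  rewrite !mxE.
  set u := (x ord0 j - _)%R.
  have /andP[h1 h2] := floor_itv ((2 : R) ^ k * u)%R.
  rewrite -(ler_pM2l e2) mulrA eN mul1r h1/=.
  by rewrite -(ltr_pM2l e2) mulrA eN mul1r h2.
split=> [_ [x xz <-]|x /key xz] /=.
  by apply/key; rewrite addrK.
by exists (x - dyadic_shift R w k)%R => //; rewrite subrK.
Qed.

Lemma cube_index_surj w k (z : 'rV[int]_n) : exists x, cube_index w k x = z.
Proof.
exists (\row_j (2 ^ (- k) * (z ord0 j)%:~R + dyadic_shift R w k ord0 j))%R.
apply/rowP => j; rewrite !mxE addrK mulrA -expfzDr ?pnatr_eq0//.
by rewrite subrr mul1r intrKfloor.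
Qed.

Lemma is_cvg_dyadic_shift w k (j : 'I_n) :
  cvgn (series (fun l : nat => ((2 : R) ^ (- (k + l.+1%:Z)) *
    (w (k + l.+1%:Z) ord0 j)%:R)%R)).
Proof.
apply: (@series_le_cvg _ _ (geometric ((2 : R) ^ (- k)) (2^-1))).
- by move=> l; rewrite mulr_ge0// exprz_ge0.
- by move=> l; rewrite mulr_ge0// ?exprz_ge0// exprn_ge0.
- move=> l /=; rewrite opprD expfzDr ?pnatr_eq0// -mulrA ler_wpM2l ?exprz_ge0//.
  rewrite exprVn -invr_expz.
  apply: (@le_trans _ _ ((2 : R) ^- l.+1)%R).
    by rewrite ler_piMr ?invr_ge0 ?exprn_ge0// lern1; case: (w _ _ _).
  by rewrite lef_pV2 ?posrE ?exprn_gt0// exprS ler_peMl ?exprn_ge0// ler1n.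
- by apply: is_cvg_geometric_series; rewrite ger0_norm// invf_lt1// ltr1n.
Qed.

(** Passing to the parent generation adds one leading term, [i = k], to the series; the remaining
    terms are those of generation [k]. *)
Lemma dyadic_shift_pred w k (j : 'I_n) :
  dyadic_shift R w (k - 1) ord0 j =
  (dyadic_shift R w k ord0 j + 2 ^ (- k) * (w k ord0 j)%:R)%R.
Proof.
rewrite !mxE; set v := (fun l : nat => _); set u := (fun l : nat => _).
have v0 : v 0%N = ((2 : R) ^ (- k) * (w k ord0 j)%:R)%R 
  by rewrite /v /= (_ : k - 1 + 1%:Z = k)%R// subrK.
have vS l : v l.+1 = u l.
  rewrite /u /v (_ : k - 1 + l.+2%:Z = k + l.+1%:Z)%R//.
  by rewrite -addn1 PoszD addrACA addNr addr0.
have sE : (fun N => series v N.+1) = (fun N => series u N + v 0%N)%R.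
  apply/funext => N; rewrite /series/= big_nat_recl//= addrC.
  by congr (_ + _)%R; apply: eq_bigr => l _; rewrite vS.
have cu : cvgn (series u) by exact: is_cvg_dyadic_shift.
rewrite -v0; apply/cvg_lim => //.
rewrite -cvg_shiftS /= sE.
by apply: cvgD => //; exact: cvg_cst.
Qed.

Lemma floor_half (a : R) (b : bool) :
  Num.floor ((a - b%:R) / 2)%R = ((Num.floor a - b%:Z) %/ 2)%Z.
Proof.
set z := Num.floor a; set q := (X in _ = X); apply: floor_def.
have /andP[h1 h2] := floor_itv a; rewrite -/z in h1 h2.
have e1 : (q * 2%Z <= z - b%:Z)%R by exact: lez_floor.
have e2 : (z - b%:Z < (q + 1) * 2%Z)%R by exact: ltz_ceil.
(* Integrality turns the strict bound into one with room for the fractional part, since [a] is only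
   known to be below [z + 1]. *)
have e3 : (z - b%:Z + 1 <= (q + 1) * 2%Z)%R by rewrite addrC lez1D.
rewrite -(ler_int R) !rmorphM !rmorphB /= in e1.
rewrite -(ler_int R) !rmorphM !rmorphD rmorphN /= in e3.
rewrite rmorphD /= in h2 *.
apply/andP; split; lra.
Qed.

(** The right side depends on [x] only through its index in generation [k]: this is why each cube
    has a parent containing it. *)
Lemma cube_index_pred w k x : cube_index w (k - 1) x =
  \row_j ((cube_index w k x ord0 j - (w k ord0 j)%:Z) %/ 2)%Z.
Proof.
apply/rowP => j; rewrite [RHS]mxE !cube_indexE -floor_half.
rewrite dyadic_shift_pred; congr Num.floor.
rewrite expfzDr ?pnatr_eq0// mulrAC; congr (_ * _)%R.
rewrite opprD addrA mulrBr; congr (_ - _)%R.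
by rewrite mulrA -expfzDr ?pnatr_eq0// subrr mul1r.
Qed.

Lemma cube_index_le w k l x y : (l <= k)%R ->
  cube_index w k x = cube_index w k y -> cube_index w l x = cube_index w l y.
Proof.
rewrite -subr_ge0; case E : (k - l)%R => [d|//] _.
have -> : l = (k - d%:Z)%R by rewrite -E opprB addrC subrK.
elim: d {E} => [|d IH] h; first by rewrite subr0.
have -> : (k - d.+1%:Z = k - d%:Z - 1)%R.
  by rewrite -addn1 PoszD opprD addrA.
by rewrite !cube_index_pred IH.
Qed.

Lemma generation_cube w k x :
  dyadic_generation R w k (cube_index w k @^-1` [set cube_index w k x]).
Proof. by rewrite dyadic_generationE; exists (cube_index w k x). Qed.

Lemma generation_nonempty w k I : dyadic_generation R w k I -> I !=set0.
Proof.
rewrite dyadic_generationE => -[z _ <-].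
by have [x xz] := cube_index_surj w k z; exists x.
Qed.

Lemma generation_subset w k l I J : (l <= k)%R ->
  dyadic_generation R w k I -> dyadic_generation R w l J ->
  I `&` J !=set0 -> I `<=` J.
Proof.
move=> lk; rewrite !dyadic_generationE => -[z _ <-] [z' _ <-] [x [/= xz xz']].
by move=> y /= yz; rewrite -xz'; apply: (cube_index_le lk); rewrite yz.
Qed.

Lemma dyadic_system_nested w I J :
  dyadic_system R w I -> dyadic_system R w J -> I `&` J !=set0 ->
  I `<=` J \/ J `<=` I.
Proof.
move=> [k _ Ik] [l _ Jl] IJ; have [lk|/ltW kl] := leP l k.
  by left; exact: (generation_subset lk Ik Jl).
by right; apply: (generation_subset kl Jl Ik); rewrite setIC.
Qed.

Hypothesis n_gt0 : (0 < n)%N.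

(* Two points half a side apart in a cube of generation [l] cannot lie in the
   same cube of a later generation. *)
Lemma generation_le w k l I :
  dyadic_generation R w k I -> dyadic_generation R w l I -> (k <= l)%R.
Proof.
move=> Ik; rewrite dyadic_generationE => -[z _ zI]; rewrite leNgt; apply/negP => lk.
pose j0 : 'I_n := Ordinal n_gt0.
pose p (c : R) : 'rV[R]_n :=
  (\row_j (2 ^ (- l) * ((z ord0 j)%:~R + c) + dyadic_shift R w l ord0 j))%R.
have pI (c : R) : (0 <= c < 1)%R -> I (p c).
  move=> /andP[c0 c1]; rewrite -zI; apply/rowP => j; rewrite !mxE addrK mulrA.
  rewrite -expfzDr ?pnatr_eq0// subrr mul1r; apply: floor_def.
  by rewrite rmorphD/= ltrD2l lerDl c0 c1.
have h0 : I (p 0%R) by apply: pI; rewrite lexx ltr01.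
have h1 : I (p 2^-1%R) by apply: pI; rewrite invr_ge0 ler0n invf_lt1// ltr1n.
move: Ik; rewrite dyadic_generationE => -[z' _ z'I].
move: h0 h1; rewrite -z'I => /= h0 h1.
have /rowP/(_ j0) := etrans h1 (esym h0); rewrite !mxE.
set A := (X in Num.floor X = _); set B := (X in _ = Num.floor X) => AB.
have /andP[_ A2] := floor_itv A; have /andP[B1 _] := floor_itv B.
have AB1 : (A - B < 1)%R.
  rewrite AB rmorphD/= in A2; rewrite ltrBlDr addrC.
  by apply: (lt_le_trans A2); rewrite lerD2r.
have : (A - B = 2 ^ (k - l) / 2)%R.
  by rewrite /A /B expfzDr ?pnatr_eq0//; field.
move=> ABE; move: AB1; rewrite ABE; apply/negP; rewrite -leNgt.
rewrite ler_pdivlMr// mul1r.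
move: lk; rewrite -subr_gt0; case: (k - l)%R => [[|d]|//] // _.
by rewrite -exprnP exprS ler_peMr// exprn_ege1// ler1n.
Qed.

Lemma ancestor_generation w k (i : nat) I : dyadic_generation R w k I ->
  dyadic_generation R w (k - i%:Z)%R (ancestor w i I) /\ I `<=` ancestor w i I.
Proof.
move=> Ik.
have [x Ix] := generation_nonempty Ik.
have le : (k - i%:Z <= k)%R by rewrite gerBl.
have Jk := generation_cube w (k - i%:Z)%R x.
have sub := generation_subset le Ik Jk (ex_intro _ x (conj Ix erefl)).
(* The cube of generation [k - i] through [x] is a candidate, which excludes the default value of
   [xget]. *)
rewrite /ancestor; case: xgetP => [J _ [g [Ig Jg IJ]]|none]; last first.
  case: (none (cube_index w (k - i%:Z)%R @^-1`
    [set cube_index w (k - i%:Z)%R x])).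
  by exists k.
(* The definition provides some generation [g] of [I]; a set has only one generation because
   [n > 0]. *)
split=> //; suff -> : k = g by [].
by apply/le_anti/andP; split; [exact: generation_le Ik Ig|exact: generation_le Ig Ik].
Qed.

End DyadicSystem.

(** * Disjoint cores carrying half of the mass *)

Section HalfCover.
Context d1 d2 (T1 : measurableType d1) (T2 : measurableType d2) (R : realType).
Variables (m1 : {sigma_finite_measure set T1 -> \bar R}).
Variables (m2 : {sigma_finite_measure set T2 -> \bar R}).

(** Only order relations between sides matter here: [L Q] stands for the ancestor of [Q.1], and
    2-maximality survives as the reversed inclusion of second sides. The cores [E Q] are disjoint
    subsets of [Omega], each with at least half the mass of its rectangle. *)
Lemma half_cover_sum (s : seq (set T1 * set T2)) (Omega : set (T1 * T2))
    (L : set T1 * set T2 -> set T1) : uniq s ->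
  measurable Omega ->
  (forall Q, Q \in s -> [/\ measurable Q.1, measurable Q.2, measurable (L Q),
     m1 (L Q) < +oo & m2 Q.2 < +oo]) ->
  (forall Q, Q \in s -> Q.1 `*` Q.2 `<=` Omega) ->
  (forall Q Q', Q \in s -> Q' \in s -> Q.1 `&` Q'.1 !=set0 ->
     Q.1 `<=` Q'.1 \/ Q'.1 `<=` Q.1) ->
  (forall Q Q', Q \in s -> Q' \in s -> Q.1 `<=` Q'.1 -> Q.2 `&` Q'.2 !=set0 ->
     Q'.2 `<=` Q.2) ->
  (forall Q, Q \in s -> Q.1 `<=` L Q) ->
  (forall Q Q', Q \in s -> Q' \in s -> Q.1 `<` Q'.1 -> L Q `<=` Q'.1) ->
  (forall Q, Q \in s -> 2%:E * (m1 \x m2) (Omega `&` (L Q `*` Q.2)) <=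
     (m1 \x m2) (L Q `*` Q.2)) ->
  \sum_(Q <- s) (m1 \x m2) (Q.1 `*` Q.2) <= 2%:E * (m1 \x m2) Omega.
Proof.
have muE A1 A2 : measurable A1 -> measurable A2 ->
    (m1 \x m2) (A1 `*` A2) = m1 A1 * m2 A2 by exact: product_measure1E.
move=> us mO ms sO nest1 nest2 sL Lmin half.
pose A Q := \big[setU/set0]_(Q' <- s | `[< Q.1 `<` Q'.1 /\ Q.2 `&` Q'.2 !=set0 >]) Q'.2.
have AP Q y : A Q y <-> exists2 Q', Q' \in s &
    [/\ Q.1 `<` Q'.1, Q.2 `&` Q'.2 !=set0 & Q'.2 y].
  rewrite /A -bigcup_seq_cond; split.
    by move=> [Q' /= /andP[Q's /asboolP[h1 h2]] y']; exists Q'.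
  by move=> [Q' Q's [h1 h2 y']]; exists Q' => //=; rewrite Q's; apply/asboolP.
have mA Q : Q \in s -> measurable (A Q).
  rewrite /A => Qs; rewrite big_seq_cond; apply: bigsetU_measurable => Q' /andP[Q's _].
  by have [] := ms _ Q's.
have AQ Q : Q \in s -> A Q `<=` Q.2.
  by move=> Qs y /AP[Q' Q's [/properW h1 h2 y']]; exact: nest2 h2 _ y'.
pose E Q := Q.1 `*` (Q.2 `\` A Q).
have mE Q : Q \in s -> measurable (E Q).
  move=> Qs; have [m1Q m2Q _ _ _] := ms _ Qs.
  by apply: measurableX => //; apply: measurableD => //; exact: mA.
have tE : trivIset [set` s] E.
  move=> Q Q' /= Qs Q's [[x y] [[/= Qx [Qy nA]] [/= Q'x [Q'y nA']]]].
  wlog sub : Q Q' Qs Q's Qx Qy nA Q'x Q'y nA' / Q.1 `<=` Q'.1.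
    move=> W; case: (nest1 Q Q' Qs Q's); first by exists x.
      exact: W.
    by move=> h; apply/esym; exact: W.
  have h2 : Q'.2 `<=` Q.2 by apply: nest2 => //; exists y.
  (* If the inclusion were strict, [Q'] would contribute to [A Q] and [y] would lie in the removed
     set. With equal first sides, the reversed inclusion holds both ways and gives [Q = Q']. *)
  have [e|ne] := pselect (Q'.1 `<=` Q.1); last first.
    by exfalso; apply: nA; apply/AP; exists Q' => //; split=> //; exists y.
  have e1 : Q.1 = Q'.1 by apply/seteqP.
  have e2 : Q.2 = Q'.2.
    apply/seteqP; split=> //; apply: nest2 => //; by exists y.
  by rewrite (surjective_pairing Q) e1 e2 -surjective_pairing.
have mE2 Q : Q \in s -> (m1 \x m2) (Q.1 `*` Q.2) <= 2%:E * (m1 \x m2) (E Q).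
  move=> Qs; have [m1Q m2Q mLQ fL f2] := ms _ Qs.
  have mAQ := mA _ Qs.
  (* A point of [A Q] lies in some [Q'.2] with [L Q] inside [Q'.1], so the rectangle [Q'] carries
     the point into [Omega]. *)
  have sA : L Q `*` A Q `<=` Omega `&` (L Q `*` Q.2).
    move=> [x y] [/= Lx Ay]; split; last by split=> //=; exact: AQ Ay.
    have /AP[Q' Q's [h1 h2 y']] := Ay.
    by apply: (sO Q') => //; split=> //=; exact: Lmin Lx.
  have := half _ Qs; rewrite muE// => hf.
  have hA : 2%:E * (m1 (L Q) * m2 (A Q)) <= m1 (L Q) * m2 Q.2.
    rewrite -muE//; apply: le_trans hf; rewrite lee_pmul2l//.
    apply: le_measure => //; rewrite inE; first exact: measurableX.
    by apply: measurableI => //; exact: measurableX.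
  rewrite /E !muE//; last exact: measurableD.
  have fA : m2 (A Q) < +oo.
    by apply: le_lt_trans f2; apply: le_measure; rewrite ?inE//; exact: AQ.
  (* The factor [m1 (L Q)] can be cancelled only if it is nonzero; if it vanishes, [Q.1] is null as
     well. *)
  have [L0|L0] := eqVneq (m1 (L Q)) 0.
    suff -> : m1 Q.1 = 0 by rewrite !mul0e mule0.
    apply/eqP; rewrite eq_le measure_ge0 andbT -L0.
    by apply: le_measure; rewrite ?inE//; exact: sL.
  have Lgt : 0 < m1 (L Q) by rewrite lt0e L0 measure_ge0.
  have Lfin : m1 (L Q) \is a fin_num by rewrite ge0_fin_numE.
  have h2 : 2%:E * m2 (A Q) <= m2 Q.2.
    by rewrite muleCA lee_pmul2l// in hA.
  rewrite muleCA lee_wpmul2l//.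
  have -> : m2 (Q.2 `\` A Q) = m2 Q.2 - m2 (A Q).
    by rewrite measureD// setIidr//; exact: AQ.
  have F2 : m2 Q.2 \is a fin_num by rewrite ge0_fin_numE.
  have FA : m2 (A Q) \is a fin_num by rewrite ge0_fin_numE.
  rewrite -(fineK F2) -(fineK FA) -EFinM lee_fin in h2.
  rewrite -(fineK F2) -(fineK FA) -EFinB -EFinM lee_fin.
  lra.
apply: (@le_trans _ _ (\sum_(Q <- s) 2%:E * (m1 \x m2) (E Q))).
  by rewrite big_seq [leRHS]big_seq; apply: lee_sum => Q Qs; exact: mE2.
rewrite -ge0_sume_distrr//.
rewrite lee_pmul2l//.
have -> : \sum_(Q <- s) (m1 \x m2) (E Q) = (m1 \x m2) (\bigcup_(Q in [set` s]) E Q).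
  rewrite measure_fin_bigcup//=.
  by rewrite -fsbig_seq.
apply: le_measure; rewrite ?inE//.
  by apply: fin_bigcup_measurable.
apply: bigcup_sub => Q /= Qs [x y] [/= h1 [h2 _]].
by apply: (sO Q).
Qed.

End HalfCover.

(** * Bundling sigma-finiteness with a measure *)

Section SigmaFinite.
Context d (T : measurableType d) (R : realType) (mu : {measure set T -> \bar R}).
Hypothesis mu_sigma_finite : sigma_finite setT mu.

Let f : set T -> \bar R := mu.

HB.instance Definition _ := Measure.on f.
HB.instance Definition _ := @Measure_isSigmaFinite.Build _ _ _ f mu_sigma_finite.

(** The product measure results need the bundled structure, while the theorem is about plain
    measures; equality as functions allows rewriting one into the other. *)
Lemma sigma_finite_measure_of :
  exists nu : {sigma_finite_measure set T -> \bar R}, nu = mu :> (set T -> \bar R).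
Proof. by exists f. Qed.

End SigmaFinite.

(** * Measurability and finite measure of cubes *)

Section BorelMeasure.
Context {R : realType} {n : nat}.

Lemma borelRn_open (A : set 'rV[R]_n) : open A -> measurable (A : set (borelRn R n)).
Proof. exact: sub_sigma_algebra. Qed.

Lemma borelRn_closed (A : set 'rV[R]_n) :
  closed A -> measurable (A : set (borelRn R n)).
Proof.
move=> cA; rewrite -[A]setCK; apply: measurableC; apply: borelRn_open.
exact: closed_openC.
Qed.

Lemma generation_measurable (w : int -> 'rV[bool]_n) (k : int) I :
  dyadic_generation R w k I -> measurable (I : set (borelRn R n)).
Proof.
rewrite dyadic_generationE => -[z _ <-].
pose s := dyadic_shift R w k.
pose a (j : 'I_n) : R := (2 ^ (- k) * (z ord0 j)%:~R + s ord0 j)%R.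
pose b (j : 'I_n) : R := (2 ^ (- k) * (z ord0 j + 1)%:~R + s ord0 j)%R.
pose H (j : 'I_n) (c : R) : set 'rV[R]_n := [set x | (x ord0 j < c)%R].
have mH j c : measurable (H j c : set (borelRn R n)).
  apply: borelRn_open.
  apply: (@open_comp _ _ (fun x : 'rV[R]_n => x ord0 j) [set t | (t < c)%R]).
    by move=> x _; exact: coord_continuous.
  exact: open_lt.
(* A half-open cube is a finite intersection of differences of open half-spaces. *)
have -> : cube_index w k @^-1` [set z] =
    \bigcap_(j in [set: 'I_n]) (H j (b j) `\` H j (a j)).
  have e2 : (0 < (2 : R) ^ (- k))%R by rewrite exprz_gt0.
  have eN : ((2 : R) ^ (- k) * 2 ^ k = 1)%R.
    by rewrite -expfzDr ?addNr// pnatr_eq0.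
  apply/seteqP; split=> x /=.
    move=> /rowP xz j _ /=; have := xz j; rewrite cube_indexE -/s => zj.
    have /andP[h1 h2] := floor_itv (2 ^ k * (x ord0 j - s ord0 j))%R.
    rewrite zj -(ler_pM2l e2) mulrA eN mul1r lerBrDr in h1.
    rewrite zj -(ltr_pM2l e2) mulrA eN mul1r ltrBlDr in h2.
    by split; [exact: h2|apply/negP; rewrite -leNgt].
  move=> h; apply/rowP => j; rewrite cube_indexE -/s; apply: floor_def.
  have [h2 /negP] := h j Logic.I; rewrite -leNgt => h1.
  rewrite -(ler_pM2l e2) mulrA eN mul1r lerBrDr h1/=.
  by rewrite -(ltr_pM2l e2) mulrA eN mul1r ltrBlDr.
by apply: fin_bigcap_measurable => // j _; exact: measurableD.
Qed.

Lemma compact_locally_finite (mu : {measure set (borelRn R n) -> \bar R})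
    (K : set 'rV[R]_n) : locally_finite mu -> compact K -> mu K < +oo.
Proof.
move=> lf cK.
have mK : measurable (K : set (borelRn R n)).
  by apply: borelRn_closed; apply: compact_closed => //; exact: norm_hausdorff.
have /choice[U UP] := lf.
move: cK; rewrite compact_cover => /(_ _ K U); case.
- by move=> x _; have [] := UP x.
- by move=> x Kx; exists x => //; have [] := UP x.
move=> F _ KF.
rewrite /cover bigcup_seq in KF; move: KF; set V := \big[_/_]_(_ <- _) _ => KV.
have [mV fV] : measurable (V : set (borelRn R n)) /\ mu V < +oo.
  rewrite /V; elim/big_rec : _ => [|x A _ [mA fA]]; first by rewrite measure0.
  have [oU _ fU] := UP x; have mU := borelRn_open oU.
  split; first exact: measurableU.
  by apply: le_lt_trans (measureU2 _ mU mA) _; exact: lte_add_pinfty.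
by apply: le_lt_trans fV; apply: le_measure; rewrite ?inE.
Qed.

Lemma compact_box (a b : 'I_n -> R) :
  compact [set x : 'rV[R]_n | forall j, (a j <= x ord0 j <= b j)%R].
Proof.
have := @rV_compact R n (fun j => [set` `[a j, b j]%R]) (fun j => @segment_compact _ _ _).
by congr compact; apply/seteqP; split=> x /= h j; have := h j; rewrite in_itv.
Qed.

(** The cube lies in the closed box with the same corners, which is compact and hence of finite
    measure. *)
Lemma generation_locally_finite (mu : {measure set (borelRn R n) -> \bar R})
    (w : int -> 'rV[bool]_n) (k : int) I :
  locally_finite mu -> dyadic_generation R w k I -> mu I < +oo.
Proof.
move=> lf Ik; have mI := generation_measurable Ik; move: Ik => [z _ zI].
pose s := dyadic_shift R w k.
pose a (j : 'I_n) : R := (2 ^ (- k) * (z ord0 j)%:~R + s ord0 j)%R.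
pose b (j : 'I_n) : R := (2 ^ (- k) * (z ord0 j + 1)%:~R + s ord0 j)%R.
have cK := @compact_box a b; have fK := compact_locally_finite lf cK.
apply: le_lt_trans fK; apply: le_measure; rewrite ?inE//.
  by apply: borelRn_closed; apply: compact_closed => //; exact: norm_hausdorff.
rewrite -zI => _ [x xz <-] j; rewrite mxE !lerD2r.
by have /andP[-> /ltW] := xz j.
Qed.

Lemma locally_finite_sigma_finite (mu : {measure set (borelRn R n) -> \bar R}) :
  locally_finite mu -> sigma_finite setT mu.
Proof.
move=> lf; pose B (i : nat) : set 'rV[R]_n :=
  [set x | forall j, (- i%:R <= x ord0 j <= i%:R)%R].
have cB i : compact (B i) by exact: compact_box.
exists B => [|i]; last first.
  split; last exact: compact_locally_finite.
  by apply: borelRn_closed; apply: compact_closed => //; exact: norm_hausdorff.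
apply/seteqP; split=> // x _.
(* The sum of the absolute values dominates every coordinate at once. *)
exists (Num.truncn (\sum_j `|x ord0 j|)%R).+1 => // j /=; rewrite -ler_norml.
apply: le_trans (ltW (truncnS_gt _)).
by rewrite (bigD1 j)//= lerDl sumr_ge0.
Qed.

End BorelMeasure.

(** * Summation by parts and decay of [omega] *)

Lemma abel_sum_bound (R : realFieldType) (T : Type) (s : seq T) (e : T -> nat)
    (a : T -> R) (omega : nat -> R) (C : R) (N : nat) :
  (forall k, 0 <= omega k)%R -> nonincreasing_seq omega ->
  (forall k, \sum_(t <- s | (e t <= k)%N) a t <= k.+1%:R * C)%R ->
  (\sum_(t <- s | (e t < N)%N) omega (e t) * a t <= (\sum_(k < N) omega k) * C)%R.
Proof.
move=> omega0 omegaS aC.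
(* Subtracting [omega M] makes the induction close. The coefficient of [C] equals the sum of
   [(k + 1) (omega k - omega (k + 1))] over [k < M]. *)
have step M : (\sum_(t <- s | (e t < M)%N) (omega (e t) - omega M) * a t <=
    (\sum_(k < M) omega k - M%:R * omega M) * C)%R.
  elim: M => [|M IH].
    by rewrite big_pred0// big_ord0 mul0r subrr mul0r.
  (* Every old weight grows by [omega M - omega M.+1], and the new terms, those with [e t = M],
     enter with exactly this weight. *)
  have -> : (\sum_(t <- s | (e t < M.+1)%N) (omega (e t) - omega M.+1) * a t =
      \sum_(t <- s | (e t < M)%N) (omega (e t) - omega M) * a t +
      (omega M - omega M.+1) * \sum_(t <- s | (e t <= M)%N) a t)%R.
    rewrite mulr_sumr big_mkcond [X in (X + _)%R]big_mkcond.
    rewrite [X in (_ + X)%R]big_mkcond -big_split/=; apply: eq_bigr => t _.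
    rewrite ltnS; case: (ltngtP (e t) M) => [h|h|->]; last 2 first.
    - by rewrite addr0.
    - by rewrite add0r.
    - by rewrite -mulrDl addrA subrK.
  apply: (@le_trans _ _ ((\sum_(k < M) omega k - M%:R * omega M) * C +
      (omega M - omega M.+1) * (M.+1%:R * C))%R).
    by rewrite lerD// ler_wpM2l// subr_ge0 omegaS.
  rewrite big_ord_recr/= -[M.+1%:R]natr1 le_eqVlt; apply/orP; left; apply/eqP; ring.
case: N => [|N]; first by rewrite big_pred0// big_ord0 mul0r.
(* The subtracted [omega N.+1] is restored by means of the hypothesis at [N], since [e t < N.+1]
   means [e t <= N]. *)
have := step N.+1; have := ler_wpM2l (omega0 N.+1) (aC N).
rewrite mulr_sumr => h1 h2.
apply: le_trans (le_trans (lerD h1 h2) _); last first.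
  rewrite le_eqVlt; apply/orP; left; apply/eqP; ring.
rewrite -big_split/= le_eqVlt; apply/orP; left; apply/eqP; apply: eq_bigr => t _.
by rewrite -mulrDl addrC subrK.
Qed.

(** This makes rectangles of infinite embeddedness contribute zero. A positive limit bounds every
    term from below, so more than [S / limn omega] terms would already exceed the total [S]. *)
Lemma limn_summable_nonincreasing (R : realType) (omega : nat -> R) :
  (forall k, 0 <= omega k)%R -> nonincreasing_seq omega ->
  \sum_(0 <= k <oo) (omega k)%:E < +oo -> limn omega = 0%R.
Proof.
move=> omega0 omegaS Sfin.
have cv : cvgn omega.
  apply: nonincreasing_is_cvgn => //.
  by exists 0%R => _ [k _ <-].
have L0 : (0 <= limn omega)%R by apply: limr_ge => //; near=> k.
apply/eqP; rewrite eq_le L0 andbT leNgt; apply/negP => Lgt.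
have Sge0 : 0 <= \sum_(0 <= k <oo) (omega k)%:E.
  by apply: nneseries_ge0 => k _ _; rewrite lee_fin.
have SF : \sum_(0 <= k <oo) (omega k)%:E \is a fin_num by rewrite ge0_fin_numE.
set S := fine (\sum_(0 <= k <oo) (omega k)%:E).
pose N := (Num.truncn (S / limn omega)).+1.
have h : (\sum_(k < N) omega k <= S)%R.
  rewrite -lee_fin fineK// -sumEFin -(big_mkord xpredT (fun k => (omega k)%:E)).
  by apply: nneseries_lim_ge => k _ _; rewrite lee_fin.
have : (N%:R * limn omega <= S)%R.
  apply: le_trans h; rewrite mulr_natl -{1}(card_ord N) -sumr_const.
  by apply: ler_sum => k _; exact: nonincreasing_cvgn_ge.
apply/negP; rewrite -ltNge -ltr_pdivrMr//.
by rewrite truncnS_gt.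
Unshelve. all: by end_near. Qed.

(** * Measurability of [Omega] and density outside the enlargement *)

Lemma dyadic_union_measurable (R : realType) (n m : nat)
    (wn : int -> 'rV[bool]_n) (wm : int -> 'rV[bool]_m)
    (Omega : set ('rV[R]_n * 'rV[R]_m)) :
  (forall x, Omega x -> exists I J, [/\ dyadic_system R wn I,
     dyadic_system R wm J, (I `*` J) x & I `*` J `<=` Omega]) ->
  measurable (Omega : set (borelRn R n * borelRn R m)).
Proof.
move=> cover.
pose Q (u : (int * 'rV[int]_n) * (int * 'rV[int]_m)) :=
  (cube_index (R := R) wn u.1.1 @^-1` [set u.1.2]) `*`
  (cube_index (R := R) wm u.2.1 @^-1` [set u.2.2]).
(* Rectangles not inside [Omega] are replaced by the empty set, so that the union runs over a whole
   countable type. *)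
pose F u : set ('rV[R]_n * 'rV[R]_m) := if `[< Q u `<=` Omega >] then Q u else set0.
have -> : Omega = \bigcup_u F u.
  apply/seteqP; split=> [x Ox|x [u _]]; last first.
    by rewrite /F; case: asboolP => // QO /QO.
  have [I [J [[k _ Ik] [l _ Jl] IJx IJ]]] := cover x Ox.
  move: Ik Jl IJx IJ; rewrite !dyadic_generationE => -[z _ <-] [z' _ <-] Qx QO.
  by exists ((k, z), (l, z')) => //; rewrite /F asboolT.
apply: countable_bigcupT_measurable => [|u]; first exact: countableP.
rewrite /F; case: asboolP => _ //.
apply: measurableX; apply: generation_measurable; rewrite dyadic_generationE.
  by exists u.1.2.
by exists u.2.2.
Qed.

Lemma not_sub_enlargement (R : realType) (n m : nat)
    (D1 : set (set 'rV[R]_n)) (D2 : set (set 'rV[R]_m))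
    (mu : {measure set (borelRn R n * borelRn R m) -> \bar R})
    (Omega : set ('rV[R]_n * 'rV[R]_m)) (I : set 'rV[R]_n) (J : set 'rV[R]_m) :
  measurable (Omega : set (borelRn R n * borelRn R m)) ->
  measurable (I : set (borelRn R n)) -> measurable (J : set (borelRn R m)) ->
  D1 I -> D2 J -> mu (I `*` J) < +oo ->
  ~ (I `*` J `<=` enlargement D1 D2 mu Omega) ->
  2%:E * mu (Omega `&` (I `*` J)) <= mu (I `*` J).
Proof.
move=> mO mI mJ DI DJ fIJ /existsNP[p /not_implyP[IJp /negP]].
have mIJ : measurable (I `*` J : set (borelRn R n * borelRn R m)).
  exact: measurableX.
have le_IJ : mu (Omega `&` (I `*` J)) <= mu (I `*` J).
  by apply: le_measure; rewrite ?inE//; exact: measurableI.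
(* Null rectangles do not enter the supremum, but for them both sides vanish. Otherwise the average
   over [I x J] itself competes at the point [p] outside the enlargement. *)
have [IJ0|IJ0] := eqVneq (mu (I `*` J)) 0.
  rewrite IJ0 in le_IJ *.
  by rewrite mule_ge0_le0// lee_fin.
have IJgt : 0 < mu (I `*` J) by rewrite lt0e IJ0 measure_ge0.
rewrite -leNgt => sup_le.
have : (mu (I `*` J))^-1 * mu (Omega `&` (I `*` J)) <= (2^-1)%:E.
  apply: le_trans sup_le; apply: ereal_sup_ubound.
  exists (I, J) => //=; congr (_ * _).
  rewrite -integral_indic//; apply: eq_integral => y _.
  by rewrite ger0_norm// indicE.
have IJF : mu (I `*` J) \is a fin_num by rewrite ge0_fin_numE.
have OF : mu (Omega `&` (I `*` J)) \is a fin_num.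
  by rewrite ge0_fin_numE//; exact: le_lt_trans le_IJ fIJ.
have a0 : (0 < fine (mu (I `*` J)))%R by rewrite fine_gt0// IJgt.
rewrite -(fineK IJF) -(fineK OF) inver gt_eqF// -!EFinM !lee_fin.
by rewrite ler_pdivrMl// ler_pdivlMr// mulrC.
Qed.

(** * Residue classes of generations and the weighted sum *)

Section Journe.
Context {R : realType} {n m : nat}.
Variables (mun : {sigma_finite_measure set (borelRn R n) -> \bar R}).
Variables (mum : {sigma_finite_measure set (borelRn R m) -> \bar R}).
Variables (wn : int -> 'rV[bool]_n) (wm : int -> 'rV[bool]_m).
Variable Omega : set ('rV[R]_n * 'rV[R]_m).
Hypotheses (n_gt0 : (0 < n)%N).
Hypotheses (mun_lf : locally_finite mun) (mum_lf : locally_finite mum).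
Hypothesis mOmega : measurable (Omega : set (borelRn R n * borelRn R m)).

Local Notation mu := (mun \x mum).
Local Notation Dn := (dyadic_system R wn).
Local Notation Dm := (dyadic_system R wm).

Let admissible (Q : set 'rV[R]_n * set 'rV[R]_m) :=
  [/\ Dn Q.1, Dm Q.2, Q.1 `*` Q.2 `<=` Omega & two_maximal Dm Omega Q.1 Q.2].

Lemma residue_class_sum (k : nat) (g : set 'rV[R]_n -> int)
    (s : seq (set 'rV[R]_n * set 'rV[R]_m)) :
  uniq s ->
  (forall Q, Q \in s -> [/\ admissible Q, dyadic_generation R wn (g Q.1) Q.1 &
     ~ (ancestor wn k.+1 Q.1 `*` Q.2 `<=` enlargement Dn Dm mu Omega)]) ->
  (forall Q Q', Q \in s -> Q' \in s -> (g Q.1 = g Q'.1 %[mod k.+1])%Z) ->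
  \sum_(Q <- s) mu (Q.1 `*` Q.2) <= 2%:E * mu Omega.
Proof.
move=> us sP congr_g.
have LP Q : Q \in s ->
    dyadic_generation R wn (g Q.1 - k.+1%:Z)%R (ancestor wn k.+1 Q.1) /\
    Q.1 `<=` ancestor wn k.+1 Q.1.
  by move=> Qs; have [_ gQ _] := sP _ Qs; exact: ancestor_generation.
have D2f Q : Q \in s -> measurable (Q.2 : set (borelRn R m)) /\ mum Q.2 < +oo.
  move=> Qs; have [[_ [l _ Ql] _ _] _ _] := sP _ Qs.
  by split; [exact: generation_measurable Ql|exact: generation_locally_finite Ql].
apply: (@half_cover_sum _ _ _ _ _ mun mum s Omega (fun Q => ancestor wn k.+1 Q.1)) => //.
- move=> Q Qs; have [gL _] := LP _ Qs; have [_ gQ _] := sP _ Qs.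
  have [m2 f2] := D2f _ Qs; split=> //.
  + exact: generation_measurable gQ.
  + exact: generation_measurable gL.
  + exact: generation_locally_finite gL.
- by move=> Q /sP[[]].
- move=> Q Q' /sP[[D1 _ _ _] _ _] /sP[[D1' _ _ _] _ _].
  exact: dyadic_system_nested D1 D1'.
- move=> Q Q' /sP[[_ D2 _ max] _ _] /sP[[_ D2' sO _] _ _] sub1 meet2.
  case: (dyadic_system_nested D2 D2' meet2) => // sub2.
  (* If [Q'.2] were strictly larger than [Q.2], then [Q.1 x Q'.2], which lies in [Q'.1 x Q'.2] and
     so in [Omega], would contradict 2-maximality of [Q]. *)
  apply: contrapT => nsub; apply: (max _ D2'); first by split.
  by move=> [x y] [/= /sub1 ? ?]; exact: sO.
- by move=> Q /LP[].
- move=> Q Q' Qs Q's [sub nsub].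
  have [gL QL] := LP _ Qs; have [_ gQ _] := sP _ Qs; have [_ gQ' _] := sP _ Q's.
  have [x Qx] := generation_nonempty gQ.
  apply: (generation_subset _ gL gQ'); last by exists x; split; [exact: QL|exact: sub].
  have lt : (g Q'.1 < g Q.1)%R.
    rewrite ltNge; apply/negP => le; apply: nsub.
    by apply: (generation_subset le gQ' gQ); exists x; split=> //; exact: sub.
  have /eqP := congr_g _ _ Qs Q's.
  rewrite eqz_mod_dvd => /dvdzP[q qE].
  (* The generations differ by a positive multiple [q] of [k + 1], so the ancestor of order [k + 1]
     is no larger than [Q'.1]. *)
  have qgt : (0 < q)%R.
    by move: lt; rewrite -subr_gt0 qE pmulr_lgt0.
  rewrite lerBrDr -lerBrDl qE.
  by rewrite ler_peMl// -gtz0_ge1.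
- move=> Q Qs; have [gL QL] := LP _ Qs; have [[_ D2 _ _] _ nsub] := sP _ Qs.
  have [m2 f2] := D2f _ Qs; have mL := generation_measurable gL.
  have fL := generation_locally_finite mun_lf gL.
  have fR : mu (ancestor wn k.+1 Q.1 `*` Q.2) < +oo.
    by rewrite product_measure1E//; apply: lte_mul_pinfty; rewrite // ge0_fin_numE.
  apply: (@not_sub_enlargement _ _ _ Dn Dm (mun \x mum)) => //.
  by exists (g Q.1 - k.+1%:Z)%R.
Qed.

Lemma embedded_sum (k : nat) (s : seq (set 'rV[R]_n * set 'rV[R]_m)) :
  uniq s ->
  (forall Q, Q \in s -> admissible Q /\
     ~ (ancestor wn k.+1 Q.1 `*` Q.2 `<=` enlargement Dn Dm mu Omega)) ->
  \sum_(Q <- s) mu (Q.1 `*` Q.2) <= k.+1%:R%:E * (2%:E * mu Omega).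
Proof.
move=> us sP.
(* The default [0] is never taken on cubes of the system. *)
pose g (I : set 'rV[R]_n) : int := xget 0%R [set l | dyadic_generation R wn l I].
have gP I : Dn I -> dyadic_generation R wn (g I) I.
  by move=> [l _ Il]; rewrite /g; case: xgetP => [//|/(_ l)].
pose r (Q : set 'rV[R]_n * set 'rV[R]_m) : 'I_k.+1 := inord `|(g Q.1 %% k.+1%:Z)%Z|%N.
rewrite (partition_big r xpredT)//=.
apply: (@le_trans _ _ (\sum_(c < k.+1) 2%:E * mu Omega)); last first.
  rewrite -[in leRHS](card_ord k.+1) -sum1_card natr_sum -sumEFin.
  rewrite ge0_sume_distrl//; apply: lee_sum => c _.
  by rewrite mul1e.
apply: lee_sum => c _; rewrite -big_filter.
apply: (@residue_class_sum k g); first by rewrite filter_uniq.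
  move=> Q; rewrite mem_filter => /andP[_ /sP[aQ nQ]]; split=> //.
  by case: aQ => /gP.
have rE Q : (r Q : nat)%:Z = (g Q.1 %% k.+1%:Z)%Z.
  have ge := @modz_ge0 (g Q.1) k.+1%:Z isT.
  rewrite inordK ?gez0_abs// -ltz_nat gez0_abs//.
  by have := @ltz_mod (g Q.1) k.+1%:Z isT.
move=> Q Q'; rewrite !mem_filter => /andP[/eqP rQ _] /andP[/eqP rQ' _].
by rewrite -!rE rQ rQ'.
Qed.

(** Embeddedness at most [k] means that the ancestor of order [k + 1] is not embedded, so
    [embedded_sum] supplies the hypothesis of [abel_sum_bound] with [C] twice the mass of
    [Omega]. *)
Lemma journe_sigma_finite (omega : nat -> R) :
  mu Omega < +oo -> (forall k, (0 <= omega k)%R) -> nonincreasing_seq omega ->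
  \sum_(0 <= k <oo) (omega k)%:E < +oo ->
  \esum_(Q in admissible)
      (eval_sup omega (emb1 wn wm mu Omega Q.1 Q.2))%:E * mu (Q.1 `*` Q.2)
    <= 2%:E * (\sum_(0 <= k <oo) (omega k)%:E) * mu Omega.
Proof.
move=> fO omega0 omegaS Sfin.
pose emb (Q : set 'rV[R]_n * set 'rV[R]_m) := emb1 wn wm mu Omega Q.1 Q.2.
(* For [emb Q = -oo] no ancestor of [Q.1] is embedded, so the default
   [e Q = 0] still satisfies [eP]. *)
pose e Q := if emb Q is r%:E then Num.truncn r else 0%N.
have eP Q l : emb Q != +oo -> (e Q < l)%N ->
    ~ (ancestor wn l Q.1 `*` Q.2 `<=` enlargement Dn Dm mu Omega).
  move=> embQ lt sub.
  have : l%:R%:E <= emb Q by apply: ereal_sup_ubound; exists l.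
  move: embQ lt; rewrite /e; case: (emb Q) => [r||]//= _ lt.
  rewrite lee_fin leNgt => /negP; apply.
  by apply: lt_le_trans (truncnS_gt r) _; rewrite ler_nat.
(* The sum over all rectangles is a supremum of finite sums, each of which is bounded separately. *)
apply: ge_ereal_sup => _ [X [finX sX] <-].
rewrite fsbig_finite//=.
set s := finmap.enum_fset _.
have sP Q : Q \in s -> admissible Q.
  by rewrite in_fset_set// inE => /sX.
have us : uniq s by exact: finmap.fset_uniq.
have mR Q : Q \in s -> measurable (Q.1 `*` Q.2 : set (borelRn R n * borelRn R m)).
  move=> /sP[[k _ Qk] [l _ Ql] _ _].
  by apply: measurableX; [exact: generation_measurable Qk|exact: generation_measurable Ql].
have OF : mu Omega \is a fin_num by rewrite ge0_fin_numE.
have RF Q : Q \in s -> mu (Q.1 `*` Q.2) \is a fin_num.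
  move=> Qs; rewrite ge0_fin_numE//; apply: le_lt_trans fO.
  by apply: le_measure; rewrite ?inE//; [exact: mR|have [] := sP _ Qs].
have S0 : 0 <= \sum_(0 <= k <oo) (omega k)%:E.
  by apply: nneseries_ge0 => k _ _; rewrite lee_fin.
(* Rectangles of infinite embeddedness are dropped, their weight being [limn omega = 0]. *)
pose s' := [seq Q <- s | emb Q != +oo].
have s's Q : Q \in s' -> emb Q != +oo /\ Q \in s.
  by rewrite mem_filter => /andP[].
pose a Q := fine (mu (Q.1 `*` Q.2)).
have -> : \sum_(Q <- s) (eval_sup omega (emb Q))%:E * mu (Q.1 `*` Q.2) =
    (\sum_(Q <- s') omega (e Q) * a Q)%R%:E.
  rewrite -sumEFin big_filter [RHS]big_mkcond big_seq [RHS]big_seq.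
  apply: eq_bigr => Q Qs; rewrite EFinM fineK ?RF// /e.
  case: (emb Q) => [r||]//=.
  by rewrite limn_summable_nonincreasing// mul0e.
have aC k : (\sum_(Q <- s' | (e Q <= k)%N) a Q <= k.+1%:R * (2 * fine (mu Omega)))%R.
  rewrite -lee_fin -sumEFin !EFinM fineK//.
  rewrite big_seq_cond (eq_bigr (fun Q => mu (Q.1 `*` Q.2))); last first.
    by move=> Q /andP[/s's[_ Qs] _]; rewrite fineK// RF.
  rewrite -big_seq_cond -big_filter; apply: embedded_sum.
    by rewrite !filter_uniq.
  move=> Q; rewrite mem_filter => /andP[eQ /s's[embQ Qs]].
  by split; [exact: sP|exact: eP].
(* The successor of the maximum makes the restriction [e Q < N] vacuous on [s']. *)
pose N := (\max_(Q <- s') e Q).+1.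
have := abel_sum_bound N omega0 omegaS aC.
have -> : (\sum_(Q <- s' | (e Q < N)%N) omega (e Q) * a Q =
    \sum_(Q <- s') omega (e Q) * a Q)%R.
  rewrite big_seq_cond [RHS]big_seq; apply: eq_bigl => Q.
  by case Qs: (Q \in s') => //=; rewrite ltnS leq_bigmax_seq.
rewrite -lee_fin => /le_trans; apply.
rewrite !EFinM fineK// muleA -sumEFin [X in X * _]muleC lee_wpmul2r// lee_wpmul2l//.
rewrite -(big_mkord xpredT (fun k => (omega k)%:E)).
by apply: nneseries_lim_ge => k _ _; rewrite lee_fin.
Qed.

End Journe.

Theorem theorem8p1 (R : realType) (n m : nat) (n_gt0 : (0 < n)%N)
    (m_gt0 : (0 < m)%N)
    (mun : {measure set (borelRn R n) -> \bar R})
    (mum : {measure set (borelRn R m) -> \bar R})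
    (mun_lf : locally_finite mun) (mum_lf : locally_finite mum)
    (wn : int -> 'rV[bool]_n) (wm : int -> 'rV[bool]_m)
    (wn_nq : no_quadrants (dyadic_system R wn))
    (wm_nq : no_quadrants (dyadic_system R wm))
    (Omega : set ('rV[R]_n * 'rV[R]_m))
    (Omega_fin : (mun \x mum) Omega < +oo)
    (Omega_cover : forall x, Omega x -> exists I J,
       [/\ dyadic_system R wn I, dyadic_system R wm J,
           (I `*` J) x & I `*` J `<=` Omega])
    (omega : nat -> R) (omega_ge0 : forall k, (0 <= omega k)%R)
    (omega_decr : nonincreasing_seq omega)
    (omega_sum : \sum_(0 <= k <oo) (omega k)%:E < +oo) :
  \esum_(Q in [set Q : set 'rV[R]_n * set 'rV[R]_m |
         [/\ dyadic_system R wn Q.1, dyadic_system R wm Q.2,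
             Q.1 `*` Q.2 `<=` Omega &
             two_maximal (dyadic_system R wm) Omega Q.1 Q.2]])
      (eval_sup omega (emb1 wn wm (mun \x mum) Omega Q.1 Q.2))%:E
        * (mun \x mum) (Q.1 `*` Q.2)
    <= 2%:E * (\sum_(0 <= k <oo) (omega k)%:E) * (mun \x mum) Omega.
Proof.
have [mun' munE] := sigma_finite_measure_of (locally_finite_sigma_finite mun_lf).
have [mum' mumE] := sigma_finite_measure_of (locally_finite_sigma_finite mum_lf).
rewrite -munE -mumE in mun_lf mum_lf Omega_fin *.
apply: journe_sigma_finite => //; exact: dyadic_union_measurable Omega_cover.
Qed.
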